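(* Let $\alpha\in(0,1)$, $\kappa>0$, $n,T\ge2$ integers, and $\tau_0\ge\tau_1\ge\tau_2>0$. For any $\eta\in(0,1)$, define $$\mathcal{M}_*^{(1)}=\left\{A\in\mathbb{R}^{n\times T}:\ \|A\|_\infty\le\kappa(1-\eta),\ \sigma_1(A)\ge\tau_0(1+\eta),\ \sigma_2(A)=0\right\}.$$ Then $$\inf_{CI\in\Phi(\mathcal{M}^{(2)})}\ \inf_{M\in\mathcal{M}_*^{(1)}}\mathbb{E}_M|CI(X_{-1,-1})|\ \ge\ (1-2\alpha)\min\{\kappa\eta,\tau_0\eta,\tau_2\}.$$
   Context: Model: $X=M+u$ where $M\in\mathbb{R}^{n\times T}$ is non-random and the entries $u_{i,t}$ of $u\in\mathbb{R}^{n\times T}$ are i.i.d. $N(0,1)$. The observed data is $X_{-1,-1}$, i.e. all entries of $X$ except the $(1,1)$ entry (formally, $A_{-1,-1}$ is $A$ with its $(1,1)$ entry replaced by zero). $\mathbb{P}_M,\mathbb{E}_M$ denote probability and expectation when the mean matrix is $M$. For a matrix $A$, $\|A\|_\infty=\max_{i,j}|A_{i,j}|$ and $\sigma_1(A)\ge\sigma_2(A)\ge\cdots$ are its singular values. Define $\mathcal{M}=\{A\in\mathbb{R}^{n\times T}:\|A\|_\infty\le\kappa,\ \mathrm{rank}\,A\le2\}$ and $\mathcal{M}^{(2)}=\{A\in\mathcal{M}:\sigma_1(A)\ge\tau_1,\ \sigma_2(A)\le\tau_2\}$. $\Phi(\mathcal{M}^{(2)})$ is the set of (measurable) confidence intervals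 $CI(\cdot)=[l(\cdot),u(\cdot)]$, $l\le u$, with $\inf_{M\in\mathcal{M}^{(2)}}\mathbb{P}_M(M_{1,1}\in CI(X_{-1,-1}))\ge1-\alpha$; $|CI(\cdot)|=u(\cdot)-l(\cdot)$. An infimum over an empty set is $+\infty$. *)

(* Defs.v *)
From mathcomp Require Import all_boot all_order all_algebra.
From mathcomp Require Import polyrcf.
From mathcomp Require Import all_classical all_reals all_analysis.

Set Implicit Arguments.
Unset Strict Implicit.
Unset Printing Implicit Defensive.

Import Order.TTheory GRing.Theory Num.Theory.
Import numFieldNormedType.Exports.

Local Open Scope classical_set_scope.
Local Open Scope ring_scope.

(* The roots of the characteristic polynomial of A^T A, each repeated
   according to its multiplicity, in decreasing order ([rootsR] lists the
   distinct real roots in increasing order). *)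
Definition gram_eigenvalues (R : realType) (n T : nat) (A : 'M[R]_(n, T)) :
    seq R :=
  let p := char_poly (A^T *m A) in
  flatten [seq nseq (mup x p) x | x <- rev (rootsR p)].

(* [sigma k A] is the k-th largest singular value, counted from k = 1. *)
Definition sigma (R : realType) (n T : nat) (k : nat) (A : 'M[R]_(n, T)) : R :=
  nth 0 [seq Num.sqrt x | x <- gram_eigenvalues A] k.-1.

(* Row and column indices start at [ord0], so [A ord0 ord0] is the (1,1) entry.
   On matrices, [`|A|] is the largest absolute value of an entry. *)
Definition Mclass (R : realType) (n T : nat) (kappa : R) :
    set 'M[R]_(n.+1, T.+1) :=
  [set A | `|A| <= kappa /\ (\rank A <= 2)%N].

Definition Mclass2 (R : realType) (n T : nat) (kappa tau1 tau2 : R) :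
    set 'M[R]_(n.+1, T.+1) :=
  [set A | [/\ Mclass kappa A, tau1 <= sigma 1 A & sigma 2 A <= tau2]].

Definition Mstar1 (R : realType) (n T : nat) (kappa tau0 eta : R) :
    set 'M[R]_(n.+1, T.+1) :=
  [set A | [/\ `|A| <= kappa * (1 - eta), tau0 * (1 + eta) <= sigma 1 A
             & sigma 2 A = 0]].

Definition del11 (R : realType) (n T : nat) (A : 'M[R]_(n.+1, T.+1)) :
    'M[R]_(n.+1, T.+1) :=
  \matrix_(i, t) if (i == ord0) && (t == ord0) then 0 else A i t.

(* The type of matrices with the product sigma-algebra, i.e. the one generated
   by the coordinate maps (the Borel sigma-algebra of R^(n x T)). *)
Definition cylinders (R : realType) (n T : nat) : set (set 'M[R]_(n, T)) :=
  [set C | exists i t (B : set R),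
     measurable B /\ C = [set A : 'M[R]_(n, T) | B (A i t)]].

Definition Rmx (R : realType) (n T : nat) :=
  g_sigma_algebraType (@cylinders R n T).

Record confint (R : realType) (n T : nat) := ConfInt {
  ci_lo : 'M[R]_(n, T) -> R;
  ci_hi : 'M[R]_(n, T) -> R;
  ci_lo_measurable : measurable_fun [set: Rmx R n T] (ci_lo : Rmx R n T -> R);
  ci_hi_measurable : measurable_fun [set: Rmx R n T] (ci_hi : Rmx R n T -> R);
  ci_lo_le_hi : forall A, ci_lo A <= ci_hi A }.

Definition ci_set (R : realType) (n T : nat) (CI : confint R n T)
    (A : 'M[R]_(n, T)) : set R :=
  [set x | ci_lo CI A <= x <= ci_hi CI A].

Definition ci_length (R : realType) (n T : nat) (CI : confint R n T)
    (A : 'M[R]_(n, T)) : R :=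
  ci_hi CI A - ci_lo CI A.

Definition mutually_independent (R : realType) (d : measure_display)
    (Omega : measurableType d) (P : probability Omega R) (I : finType)
    (X : I -> {RV P >-> R}) : Prop :=
  forall (J : {set I}) (B : I -> set R), (forall i, measurable (B i)) ->
    P (\bigcap_(i in [set i | i \in J]) (X i @^-1` B i)) =
    (\prod_(i in J) P (X i @^-1` B i))%E.

Definition iid_std_normal (R : realType) (d : measure_display)
    (Omega : measurableType d) (P : probability Omega R) (n T : nat)
    (u : 'I_n -> 'I_T -> {RV P >-> R}) : Prop :=
  (forall i t (B : set R), measurable B ->
     distribution P (u i t) B = normal_prob 0 1 B) /\
  mutually_independent (fun it : 'I_n * 'I_T => u it.1 it.2).

Section Model.
Variables (R : realType) (d : measure_display) (Omega : measurableType d).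
Variables (P : probability Omega R) (n T : nat).
Variable u : 'I_n.+1 -> 'I_T.+1 -> {RV P >-> R}.

Definition Xmx (M : 'M[R]_(n.+1, T.+1)) (w : Omega) : 'M[R]_(n.+1, T.+1) :=
  M + \matrix_(i, t) u i t w.

(* [coverage M CI] and [expected_length M CI] are the probability that CI
   contains M_{1,1} and the expectation of |CI| when the mean matrix is M. *)
Definition coverage (M : 'M[R]_(n.+1, T.+1)) (CI : confint R n.+1 T.+1) :
    \bar R :=
  P [set w | ci_set CI (del11 (Xmx M w)) (M ord0 ord0)].

Definition expected_length (M : 'M[R]_(n.+1, T.+1))
    (CI : confint R n.+1 T.+1) : \bar R :=
  'E_P[fun w => ci_length CI (del11 (Xmx M w))].

Definition valid_confints (alpha : R) (S : set 'M[R]_(n.+1, T.+1)) :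
    set (confint R n.+1 T.+1) :=
  [set CI | ((1 - alpha)%:E <= ereal_inf [set coverage M CI | M in S])%E].

End Model.

(* Main.v *)
Require Import Defs.
From mathcomp Require Import all_boot all_order all_algebra all_fingroup.
From mathcomp Require Import all_classical all_reals all_analysis.
From mathcomp Require Import polyrcf complex sesquilinear spectral.
From mathcomp Require Import measurable_realfun ring lra.

Import Order.TTheory GRing.Theory Num.Theory.
Import numFieldNormedType.Exports.

Local Open Scope classical_set_scope.
Local Open Scope ring_scope.
Local Open Scope sesquilinear_scope.

(** The bound is a two-point argument. Take [M] in the smaller class and put
    [m = min (kappa * eta) (tau0 * eta) tau2]. Shifting the (1,1) entry of [M]
    by some [a] in [0, m] does not change the law of the data, because the
    (1,1) entry is not observed; indeed the data is the same function of the
    noise ([del11_delta]). All shifted matrices lie in the larger class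
    ([Mclass2_perturb]), so a valid interval, computed from the data under [M],
    contains each of [M_11] and [M_11 + m] with probability at least
    [1 - alpha]. By Bonferroni it contains both with probability at least
    [1 - 2 * alpha], and then its length is at least [m]
    ([expected_length_ge]).

    Membership of [M + a E_11] in the larger class is the linear algebra. The
    entry bound is the triangle inequality. A matrix with [sigma_2 = 0] has rank
    at most 1 ([sigma0_rank]), so the shifted matrix has rank at most 2. Adding
    [a E_11] moves each singular value by at most [a] ([sigma_add_entry]), which
    is an instance of the Weyl perturbation inequality ([sigma_weyl]): hence
    [sigma_1] stays above [tau0 * (1 + eta) - tau0 * eta = tau0 >= tau1], and
    [sigma_2] stays below [tau2].

    The singular values being defined through the real roots of the
    characteristic polynomial of [A^T A], everything about them rests on
    [singular_basis]: [A^T A] is diagonal in some orthonormal basis, with the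
    squares of the singular values on the diagonal, in decreasing order and
    without omission. That basis is taken over the complex numbers, where the
    spectral theorem for normal matrices provides it directly; only the
    eigenvalues have to be real, and vectors with complex coordinates serve as
    well as real ones in the variational arguments. *)

Set Implicit Arguments.
Unset Strict Implicit.
Unset Printing Implicit Defensive.

Local Notation toC := (real_complex _).
Local Notation "''[' u , v ]" := (dotmx u v) : ring_scope.
Local Notation "''[' u ]" := (dotmx u u) : ring_scope.
Local Notation cmx := (map_mx (real_complex _)).

(** * Characteristic polynomials of diagonalizable matrices *)

Section CharPoly.
Variable F : fieldType.

Lemma char_poly_conj n (V A D : 'M[F]_n) :
  V \in unitmx -> A = invmx V *m D *m V -> char_poly A = char_poly D.
Proof.
move=> Vu ->; rewrite /char_poly /char_poly_mx.
have -> : 'X%:M - map_mx polyC (invmx V *m D *m V) =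
    map_mx polyC (invmx V) *m ('X%:M - map_mx polyC D) *m map_mx polyC V.
  rewrite mulmxBr mulmxBl -!map_mxM/=; congr (_ - _).
  by rewrite scalar_mxC -mulmxA -map_mxM mulVmx// map_mx1 mulmx1.
by rewrite !det_mulmx mulrAC -det_mulmx -map_mxM mulVmx// map_mx1 det1 mul1r.
Qed.

Lemma char_poly_diag n (d : 'rV[F]_n) :
  char_poly (diag_mx d) = \prod_(i < n) ('X - (d 0 i)%:P).
Proof.
rewrite char_poly_trig.
  by apply: eq_bigr => i _; rewrite mxE eqxx.
by apply/is_trig_mxP => i j lt_ij; rewrite !mxE -val_eqE ltn_eqF ?mulr0n.
Qed.

End CharPoly.

(** * Singular values as square roots of the spectrum of the Gram matrix *)

Section SingularValues.
Variable R : realType.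

Lemma mem_rootsR (p : {poly R}) x : p != 0 -> (x \in rootsR p) = root p x.
Proof. by move=> p0; rewrite -(roots_on_rootsR p0) inE. Qed.

Lemma sorted_flatten_nseq (m : R -> nat) (s : seq R) :
  sorted >%R s -> sorted >=%R (flatten [seq nseq (m x) x | x <- s]).
Proof.
have gt_trans := rev_trans (@lt_trans _ R).
rewrite (sorted_pairwise gt_trans) (sorted_pairwise ge_trans).
elim: s => //= x s IH /andP[xs /IH {}IH].
rewrite pairwise_cat IH andbT; apply/andP; split; last first.
  elim: (m x) => //= k ->; rewrite andbT; apply/allP => y /nseqP[-> _].
  exact: lexx.
apply/allrelP => y z /nseqP[-> _] /flatten_mapP[t ts /nseqP[-> _]].
by move/allP: xs => /(_ _ ts) /ltW.
Qed.

Lemma sorted_gram_eigenvalues n T (A : 'M[R]_(n, T)) :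
  sorted >=%R (gram_eigenvalues A).
Proof.
by apply: sorted_flatten_nseq; rewrite rev_sorted; exact: sorted_roots.
Qed.

Lemma sigma_ge0 n T k (A : 'M[R]_(n, T)) : 0 <= sigma k A.
Proof.
rewrite /sigma; have [h|h] := ltnP k.-1 (size (gram_eigenvalues A)).
  by rewrite (nth_map 0)// sqrtr_ge0.
by rewrite nth_default// size_map.
Qed.

(** Past the end of the list of eigenvalues the singular values are 0 by
    default, so monotonicity holds without any bound on the indices. *)
Lemma sigma_nincr n T i j (A : 'M[R]_(n, T)) :
  (i <= j)%N -> sigma j A <= sigma i A.
Proof.
move=> ij; have [h|h] := ltnP j.-1 (size (gram_eigenvalues A)); last first.
  by rewrite {1}/sigma nth_default ?size_map// sigma_ge0.
have ij1 : (i.-1 <= j.-1)%N by rewrite -!subn1 leq_sub2r.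
rewrite /sigma !(nth_map 0) ?(leq_ltn_trans ij1 h)// ler_wsqrtr//.
apply: (sorted_leq_nth ge_trans ge_refl 0 (sorted_gram_eigenvalues A)) => //.
by rewrite inE (leq_ltn_trans ij1 h).
Qed.

(** When the characteristic polynomial splits, both lists are decreasing and
    contain each root as often as its multiplicity. *)
Lemma gram_eigenvaluesE n T (A : 'M[R]_(n, T)) (s : seq R) :
  char_poly (A^T *m A) = \prod_(x <- s) ('X - x%:P) ->
  gram_eigenvalues A = sort >=%R s.
Proof.
move=> Ep; apply: (@sorted_eq _ >=%R).
- exact: ge_trans.
- exact: ge_anti.
- exact: sorted_gram_eigenvalues.
- by apply: sort_sorted => x y; exact: le_total.
rewrite perm_sym perm_sort perm_sym.
rewrite /gram_eigenvalues {}Ep; set p := (\prod_(x <- s) _).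
have p0 : p != 0 by rewrite monic_neq0// monic_prod_XsubC.
rewrite (perm_trans _ (perm_count_undup s))//.
have -> : [seq nseq (mup x p) x | x <- rev (rootsR p)] =
          [seq nseq (count_mem x s) x | x <- rev (rootsR p)].
  by apply: eq_map => x; rewrite mu_prod_XsubC.
apply/perm_flatten/perm_map/uniq_perm; rewrite ?rev_uniq ?undup_uniq//.
  exact: uniq_roots.
by move=> x; rewrite mem_rev mem_rootsR// mem_undup root_prod_XsubC.
Qed.

(** * An orthonormal basis of right singular vectors *)

Lemma cmx_trC m n (A : 'M[R]_(m, n)) : (cmx A)^t* = cmx A^T.
Proof.
by apply/matrixP=> i j; rewrite !mxE; apply/CrealP; rewrite complex_real.
Qed.

Lemma dotmx_gram n T p (A : 'M[R]_(n, T)) (U : 'M[R[i]]_(p, T)) i j :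
  '[row i U *m cmx A^T, row j U *m cmx A^T] =
  (U *m cmx (A^T *m A) *m U^t*) i j.
Proof.
rewrite dotmxE trmx_mul map_mxM cmx_trC trmxK mulmxA -!row_mul.
rewrite map_mxM !mulmxA !mxE.
by apply: eq_bigr => k _; rewrite !mxE.
Qed.

(** [A^T A] is real symmetric, so over the complex numbers some unitary matrix
    diagonalizes it, and its eigenvalues are real. They are therefore all the
    roots of the characteristic polynomial, and it suffices to permute the basis
    so as to put them in decreasing order. Each is the squared norm of the image
    of a basis vector under [A], hence nonnegative, and the square root in the
    definition of the singular values can be undone. *)
Lemma singular_basis n T (A : 'M[R]_(n, T)) :
  exists2 V : 'M[R[i]]_T, V \is unitarymx &
    V *m cmx (A^T *m A) *m V^t* = diag_mx (\row_i toC (sigma i.+1 A ^+ 2)).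
Proof.
set S : 'M[R[i]]_T := cmx (A^T *m A).
have Ssym : S \is symmetricmx.
  apply/is_hermitianmxP; rewrite expr0 scale1r map_mx_id//.
  by rewrite /S map_trmx trmx_mul trmxK.
have Sreal : S \is a mxOver Num.real.
  by apply/mxOverP => i j; rewrite mxE complex_real.
have /orthomx_spectralP := symmetric_normalmx Ssym Sreal.
have := hermitian_spectral_diag_real (realsym_hermsym Ssym Sreal).
have := spectral_unitarymx S.
move: (spectralmx S) (spectral_diag S) => U dC Uu dCreal ES.
pose d i := complex.Re (dC 0 i).
have dE i : dC 0 i = toC (d i) by rewrite RRe_real//; exact/mxOverP.
have UsU : U *m S *m U^t* = diag_mx dC.
  rewrite ES !mulmxA mulmxV ?unitarymx_unit// mul1mx.
  by rewrite -mulmxA (unitarymxP Uu) mulmx1.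
have d_ge0 i : 0 <= d i.
  have : (U *m S *m U^t*) i i = toC (d i) by rewrite UsU mxE eqxx dE.
  by rewrite -lecR => <-; rewrite -dotmx_gram dnorm_ge0.
have Ep : char_poly (A^T *m A) = \prod_(x <- codom d) ('X - x%:P).
  apply: (map_poly_inj (real_complex R)).
  rewrite map_char_poly -/S (char_poly_conj (unitarymx_unit Uu) ES).
  rewrite char_poly_diag rmorph_prod/= big_image/=.
  by apply: eq_bigr => i _; rewrite rmorphB/= map_polyX map_polyC/= -dE.
have gE := gram_eigenvaluesE Ep.
have szg : size (gram_eigenvalues A) = T.
  by rewrite gE size_sort size_codom card_ord.
have /tuple_permP[p gp] : perm_eq (gram_eigenvalues A) [tuple d i | i < T].
  by rewrite gE perm_sort.
have sE (i : 'I_T) : sigma i.+1 A = Num.sqrt (d (p i)).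
  rewrite /sigma /= (nth_map 0) ?szg// gp.
  by rewrite -tnth_nth !tnth_mktuple.
exists (row_perm p U).
  apply/row_unitarymxP => i j; rewrite !row_permEsub !row_rowsub.
  by have /row_unitarymxP -> := Uu; rewrite (inj_eq perm_inj).
apply/matrixP => i j; rewrite -dotmx_gram !row_permEsub !row_rowsub.
by rewrite dotmx_gram -/S UsU !mxE (inj_eq perm_inj) dE sE sqr_sqrtr.
Qed.

(** * The Weyl perturbation inequality *)

Definition nrm T (x : 'rV[R[i]]_T) := sqrtC '[x].

Lemma dnorm_unitary T (V : 'M[R[i]]_T) (c : 'rV_T) :
  V \is unitarymx -> '[c *m V] = '[c].
Proof.
move=> /unitarymxP Vu.
by rewrite !dotmxE trmx_mul map_mxM mulmxA -(mulmxA c) Vu mulmx1.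
Qed.

Lemma dnormE T (c : 'rV[R[i]]_T) : '[c] = \sum_i `|c 0 i| ^+ 2.
Proof. by rewrite dotmxE mxE; apply: eq_bigr => i _; rewrite !mxE normCK. Qed.

Section SingularCoordinates.
Variables (n T : nat) (A : 'M[R]_(n, T)) (V : 'M[R[i]]_T).
Hypothesis Vu : V \is unitarymx.
Hypothesis VA :
  V *m cmx (A^T *m A) *m V^t* = diag_mx (\row_i toC (sigma i.+1 A ^+ 2)).

Lemma dnorm_mulA c :
  '[c *m V *m cmx A^T] = \sum_(i < T) toC (sigma i.+1 A ^+ 2) * `|c 0 i| ^+ 2.
Proof.
have := dotmx_gram A (c *m V) 0 0; rewrite !row_id// => ->.
have -> : c *m V *m cmx (A^T *m A) *m (c *m V)^t* =
    c *m (V *m cmx (A^T *m A) *m V^t*) *m c^t*.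
  by rewrite trmx_mul (map_mxM Num.Def.conjC) !mulmxA.
by rewrite VA mxE; apply: eq_bigr => i _; rewrite mul_mx_diag !mxE normCK; ring.
Qed.

(** On the span of the first [k + 1] singular vectors, [A] stretches by at
    least the smallest singular value involved. *)
Lemma nrm_mulA_ge k (c : 'rV_T) : (forall i : 'I_T, (k < i)%N -> c 0 i = 0) ->
  toC (sigma k.+1 A) * nrm (c *m V) <= nrm (c *m V *m cmx A^T).
Proof.
move=> c0.
rewrite -ler_sqr ?nnegrE ?mulr_ge0 ?sqrtC_ge0 ?dnorm_ge0 ?lecR ?sigma_ge0//.
rewrite exprMn !sqrtCK dnorm_mulA dnorm_unitary// dnormE mulr_sumr.
apply: ler_sum => i _; have [ik|/c0->] := leqP i k; last first.
  by rewrite normr0 expr0n !mulr0.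
by rewrite ler_wpM2r// -rmorphXn lecR lerXn2r ?nnegrE ?sigma_ge0// sigma_nincr.
Qed.

(** Dually, orthogonally to the first [k] singular vectors, [A] stretches by at
    most the largest singular value left. *)
Lemma nrm_mulA_le k (c : 'rV_T) : (forall i : 'I_T, (i < k)%N -> c 0 i = 0) ->
  nrm (c *m V *m cmx A^T) <= toC (sigma k.+1 A) * nrm (c *m V).
Proof.
move=> c0.
rewrite -ler_sqr ?nnegrE ?mulr_ge0 ?sqrtC_ge0 ?dnorm_ge0 ?lecR ?sigma_ge0//.
rewrite exprMn !sqrtCK dnorm_mulA dnorm_unitary// dnormE mulr_sumr.
apply: ler_sum => i _; have [ik|/c0->] := leqP k i; last first.
  by rewrite normr0 expr0n !mulr0.
by rewrite ler_wpM2r// -rmorphXn lecR lerXn2r ?nnegrE ?sigma_ge0// sigma_nincr.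
Qed.
End SingularCoordinates.

(** The span of the first [k + 1] vectors of one basis meets the orthogonal
    complement of the first [k] vectors of the other: the latter imposes only
    [k] linear conditions on the [k + 1] coordinates in the former. *)
Lemma exists_low_high T (V1 V2 : 'M[R[i]]_T) k :
  (k < T)%N -> V1 \is unitarymx -> V2 \is unitarymx ->
  exists c d : 'rV_T, [/\ c *m V1 = d *m V2, c != 0,
    forall i : 'I_T, (k < i)%N -> c 0 i = 0 &
    forall i : 'I_T, (i < k)%N -> d 0 i = 0].
Proof.
move=> kT V1u V2u.
pose W : 'M[R[i]]_(k.+1, T) := pid_mx k.+1.
pose N := W *m V1 *m V2^t* *m (pid_mx k : 'M[R[i]]_(T, k)).
have /rowV0Pn[y] : kermx N != 0.
  by rewrite -mxrank_eq0 mxrank_ker -lt0n subn_gt0 ltnS rank_leq_col.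
move=> /sub_kermxP yN y0; exists (y *m W), (y *m W *m V1 *m V2^t*); split.
- by rewrite mulmxKtV.
- apply: contraNneq y0 => yW.
  by rewrite -[y]mulmx1 -pid_mx_1 -(pid_mx_id _ _ _ kT) mulmxA yW mul0mx.
- move=> i ki; rewrite mxE big1// => j _; rewrite mxE.
  by case: eqP => [ji|_]; rewrite ?mulr0// ji ltnS leqNgt ki mulr0.
- move=> i ik; have /rowP/(_ (Ordinal ik)) :
      y *m W *m V1 *m V2^t* *m (pid_mx k : 'M[R[i]]_(T, k)) = 0.
    by rewrite -!mulmxA -[RHS]yN /N !mulmxA.
  rewrite mxE (bigD1 i)//= big1 => [|j ji]; rewrite !mxE/=.
    by rewrite eqxx ik mulr1 addr0.
  by move: ji; rewrite -val_eqE => /negPf /= ->; rewrite mulr0.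
Qed.

(** Test both matrices on a common vector that is low in a singular basis of
    [A + B] and high in one of [A]. *)
Lemma sigma_weyl n T (A B : 'M[R]_(n, T)) b k : (k < T)%N ->
  (forall x, nrm (x *m cmx B^T) <= toC b * nrm x) ->
  sigma k.+1 (A + B) <= sigma k.+1 A + b.
Proof.
move=> kT hB.
have [V1 V1u VAB] := singular_basis (A + B).
have [V2 V2u VA] := singular_basis A.
have [c [d [E c0 c_low d_high]]] := exists_low_high kT V1u V2u.
have x0 : 0 < nrm (c *m V1) by rewrite sqrtC_gt0 dnorm_unitary// dnorm_gt0.
rewrite -lecR -(ler_pM2r x0) rmorphD/= mulrDl.
apply: (le_trans (nrm_mulA_ge V1u VAB c_low)).
rewrite linearD/= map_mxD mulmxDr.
apply: (le_trans (triangle_lerif _ _ _)).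
apply: lerD; last exact: hB.
by rewrite E; exact: nrm_mulA_le.
Qed.

(** * Rank and single-entry perturbations *)

(** [A] kills all singular vectors from the index [k] on (counted from 0), so
    its image is spanned by the images of the first [k] of them. *)
Lemma sigma0_rank n T (A : 'M[R]_(n, T)) k :
  sigma k.+1 A = 0 -> (\rank A <= k)%N.
Proof.
move=> sk0; have [Tk|/ltnW kT] := leqP T k.
  exact: leq_trans (rank_leq_col A) Tk.
have [V Vu VA] := singular_basis A.
rewrite -(mxrank_map (real_complex R)) -mxrank_tr map_trmx.
rewrite -(eqmxMfull _ (_ : row_full V)) ?row_full_unit ?unitarymx_unit//.
have -> : V *m cmx A^T = pid_mx k *m (V *m cmx A^T).
  apply/matrixP => i j.
  rewrite [RHS]mxE (bigD1 i)//= big1 => [|l li]; last first.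
    move: li; rewrite [pid_mx _ _ _]mxE eq_sym -val_eqE => /negPf/= ->.
    by rewrite mul0r.
  rewrite [pid_mx _ _ _]mxE eqxx addr0.
  have [ik|ki] := ltnP i k; first by rewrite mul1r.
  suff /rowP/(_ j) : row i V *m cmx A^T = 0 by rewrite -row_mul mul0r !mxE.
  apply/eqP; rewrite -(dnorm_eq0 (@dotmx _ _))/= dotmx_gram VA !mxE eqxx.
  have -> : sigma i.+1 A = 0.
    by apply: le_anti; rewrite sigma_ge0 -sk0 sigma_nincr.
  by rewrite expr0n.
by rewrite (leq_trans (mxrankM_maxl _ _))// rank_pid_mx.
Qed.

Lemma nrm_mul_delta n T (i : 'I_n) (j : 'I_T) (a : R) (x : 'rV_T) :
  nrm (x *m cmx (a *: delta_mx i j)^T) <= toC `|a| * nrm x.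
Proof.
have -> : x *m cmx (a *: delta_mx i j)^T = (toC a * x 0 j) *: delta_mx 0 i.
  apply/rowP => l; rewrite !mxE (bigD1 j)//= big1.
    rewrite !mxE !eqxx andbT rmorphM/= addr0 rmorph_nat.
    by rewrite mulrA (mulrC (toC a)).
  by move=> m mj; rewrite !mxE (negPf mj) andbF !mulr0.
rewrite -ler_sqr ?nnegrE ?mulr_ge0 ?sqrtC_ge0 ?dnorm_ge0 ?lecR//.
have delta1 : '[delta_mx 0 i : 'rV[R[i]]_n] = 1.
  rewrite dnormE (bigD1 i)//= big1 => [|l li]; last first.
    by rewrite mxE (negPf li) andbF normr0 expr0n.
  by rewrite mxE !eqxx normr1 expr1n addr0.
rewrite exprMn !sqrtCK dnormZ/= delta1 mulr1 normrM exprMn.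
have -> : `|toC a| = toC `|a| by rewrite normc_def /= expr0n addr0 sqrtr_sqr.
rewrite ler_wpM2l ?exprn_ge0 ?lecR// dnormE (bigD1 j)//= lerDl.
by apply: sumr_ge0 => l _; rewrite exprn_ge0.
Qed.

Lemma sigma_add_entry n T (A : 'M[R]_(n, T)) i j (a : R) k : (k < T)%N ->
  sigma k.+1 (A + a *: delta_mx i j) <= sigma k.+1 A + `|a|.
Proof. by move=> kT; apply: sigma_weyl => // x; exact: nrm_mul_delta. Qed.
End SingularValues.

(** * Intervals that cover two points *)

Section TwoPoints.
Context d (Omega : measurableType d) (R : realType) (P : probability Omega R).

Lemma bonferroni2 (A B : set Omega) alpha :
  measurable A -> measurable B ->
  ((1 - alpha)%:E <= P A)%E -> ((1 - alpha)%:E <= P B)%E ->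
  ((1 - 2 * alpha)%:E <= P (A `&` B))%E.
Proof.
move=> mA mB hA hB.
have PC (C : set Omega) : measurable C ->
    ((1 - alpha)%:E <= P C)%E -> (P (~` C) <= alpha%:E)%E.
  move=> mC; rewrite probability_setC//.
  rewrite -(fineK (fin_num_measure P _ mC)) -EFinB !lee_fin; lra.
have hC : (P (~` (A `&` B)) <= (2 * alpha)%:E)%E.
  rewrite setCI (le_trans (measureU2 P _ _))//; [exact: measurableC..|].
  rewrite mulr_natl mulr2n EFinD leeD//; exact: PC.
have mAB : measurable (A `&` B) by exact: measurableI.
move: hC; rewrite probability_setC//.
rewrite -(fineK (fin_num_measure P _ mAB)) -EFinB !lee_fin; lra.
Qed.

(** On the event that the interval contains both [a] and [b], its length is at
    least [b - a]; elsewhere it is nonnegative. *)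
Lemma expected_length_ge (lo hi : Omega -> R) (a b alpha : R) :
  measurable_fun setT lo -> measurable_fun setT hi ->
  (forall w, lo w <= hi w) -> a <= b ->
  ((1 - alpha)%:E <= P [set w | (lo w <= a <= hi w)%R])%E ->
  ((1 - alpha)%:E <= P [set w | (lo w <= b <= hi w)%R])%E ->
  (((1 - 2 * alpha) * (b - a))%:E <= 'E_P[fun w => (hi w - lo w)%R])%E.
Proof.
move=> mlo mhi lohi ab hA hB.
pose E x := [set w | lo w <= x <= hi w].
have mE x : measurable (E x).
  have -> : E x = [set w | lo w <= x] `&` [set w | x <= hi w].
    by apply/seteqP; split => w /= /andP.
  apply: measurableI; rewrite -[X in measurable X]setTI.
  - exact: (mlo measurableT _ (measurable_itv `]-oo, x])).
  - have -> : [set w | x <= hi w] = hi @^-1` `[x, +oo[.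
      by apply/seteqP; split => w /=; rewrite in_itv/= andbT.
    exact: (mhi measurableT _ (measurable_itv `[x, +oo[)).
have mEab : measurable (E a `&` E b) by exact: measurableI.
have mlen : measurable_fun [set: Omega] (fun w => (hi w - lo w)%:E : \bar R).
  by apply/measurable_EFinP/measurable_funB.
have len0 w : (0 <= (hi w - lo w)%:E)%E by rewrite lee_fin subr_ge0.
rewrite unlock.
apply: (@le_trans _ _ (\int[P]_(w in E a `&` E b) (hi w - lo w)%:E)%E);
  last first.
  by apply: ge0_subset_integral.
apply: (@le_trans _ _ (\int[P]_(w in E a `&` E b) (b - a)%:E)%E); last first.
  apply: ge0_le_integral => //.
  - by move=> w _; rewrite lee_fin subr_ge0.
  - exact: measurable_funTS.
  - move=> w [/= /andP[h1 h2] /andP[h3 h4]]; rewrite lee_fin; lra.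
rewrite integral_cst// mulrC EFinM lee_wpmul2l ?lee_fin ?subr_ge0//.
exact: bonferroni2.
Qed.
End TwoPoints.

(** * The observed data and the shifted mean *)

Section ObservedData.
Context d (Omega : measurableType d) (R : realType) (P : probability Omega R).
Variables (n T : nat) (u : 'I_n.+1 -> 'I_T.+1 -> {RV P >-> R}).

(** The sigma-algebra on matrices is generated by the coordinates, so it
    suffices that every entry of the data is a random variable. *)
Lemma measurable_del11 (M : 'M[R]_(n.+1, T.+1)) :
  measurable_fun [set: Omega] (fun w => del11 (Xmx u M w) : Rmx R n.+1 T.+1).
Proof.
apply: (@measurability _ _ Omega (Rmx R n.+1 T.+1) _ _
  (@cylinders R n.+1 T.+1)) => //.
move=> _ [_ [i [t [B [mB ->]]]] <-].
pose f w := del11 (Xmx u M w) i t.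
have mf : measurable_fun [set: Omega] f.
  have [it|it] := boolP ((i == ord0) && (t == ord0)).
    rewrite (_ : f = cst 0); first exact: measurable_cst.
    by apply/funext => w; rewrite /f mxE it.
  rewrite (_ : f = cst (M i t) \+ u i t); first exact: measurable_funD.
  by apply/funext => w; rewrite /f mxE (negPf it) !mxE.
exact: (mf measurableT B mB).
Qed.
End ObservedData.

Lemma normr_delta_mx_le (R : realType) n T (i : 'I_n.+1) (j : 'I_T.+1) :
  `|delta_mx i j : 'M[R]_(n.+1, T.+1)| <= 1.
Proof.
set D : 'M[R]_(n.+1, T.+1) := delta_mx i j.
have [D0|/mx_norm_neq0[ij Dij]] := eqVneq (mx_norm D) 0.
  by have -> : `|D| = 0 := D0; exact: ler01.
have -> : `|D| = `|D ij.1 ij.2| := Dij.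
by rewrite mxE normr_nat lern1 leq_b1.
Qed.

Lemma del11_delta (R : realType) (d : measure_display)
    (Omega : measurableType d) (P : probability Omega R) n T
    (u : 'I_n.+1 -> 'I_T.+1 -> {RV P >-> R})
    (M : 'M[R]_(n.+1, T.+1)) a w :
  del11 (Xmx u (M + a *: delta_mx ord0 ord0) w) = del11 (Xmx u M w).
Proof.
apply/matrixP => i t; rewrite !mxE; case: ifP => // it.
by rewrite it mulr0 addr0.
Qed.

(** The upper bounds on the shift are what each constraint of the larger class
    allows: [kappa * eta] for the entries, [tau0 * eta] for the first singular
    value and [tau2] for the second. *)
Lemma Mclass2_perturb (R : realType) n T (kappa tau0 tau1 tau2 eta a : R)
    (M : 'M[R]_(n.+2, T.+2)) :
  tau1 <= tau0 -> 0 <= a ->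
  a <= kappa * eta -> a <= tau0 * eta -> a <= tau2 ->
  Mstar1 kappa tau0 eta M ->
  Mclass2 kappa tau1 tau2 (M + a *: delta_mx ord0 ord0).
Proof.
move=> t01 a0 ak at0 at2 [Mk M1 M2]; split; first split.
- have := ler_normD M (a *: delta_mx ord0 ord0).
  have : `|a *: delta_mx ord0 ord0 : 'M[R]_(n.+2, T.+2)| <= a.
    by rewrite normrZ ger0_norm// ler_piMr// normr_delta_mx_le.
  lra.
- apply: (leq_trans (mxrank_add _ _)); apply: (@leq_add _ _ 1 1).
    exact: sigma0_rank.
  by rewrite (leq_trans (mxrank_scale _ _))// mxrank_delta.
(* The lower bound on the first singular value comes from the upper bound of the
   perturbation inequality, applied to the reverse shift. *)
- have := sigma_add_entry (M + a *: delta_mx ord0 ord0) ord0 ord0 (- a)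
    (isT : (0 < T.+2)%N).
  rewrite -addrA -scalerDl subrr scale0r addr0 normrN ger0_norm//; lra.
- have := sigma_add_entry M ord0 ord0 a (isT : (1 < T.+2)%N).
  rewrite M2 ger0_norm//; lra.
Qed.

Theorem theorem5 (R : realType) (n T : nat)
    (d : measure_display) (Omega : measurableType d) (P : probability Omega R)
    (u : 'I_n.+2 -> 'I_T.+2 -> {RV P >-> R}) (hu : iid_std_normal u)
    (alpha kappa tau0 tau1 tau2 eta : R)
    (halpha0 : 0 < alpha) (halpha1 : alpha < 1) (hkappa : 0 < kappa)
    (htau01 : tau1 <= tau0) (htau12 : tau2 <= tau1) (htau2 : 0 < tau2)
    (heta0 : 0 < eta) (heta1 : eta < 1) :
  (((1 - 2 * alpha) *
     Num.min (Num.min (kappa * eta) (tau0 * eta)) tau2)%:E <=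
   ereal_inf
     [set ereal_inf [set expected_length u M CI | M in Mstar1 kappa tau0 eta]
       | CI in valid_confints u alpha (Mclass2 kappa tau1 tau2)])%E.
Proof.
set m := Num.min _ _.
have m_gt0 : 0 < m.
  by rewrite !lt_min !mulr_gt0//= (lt_le_trans htau2 (le_trans htau12 htau01)).
have [mk mt m2] : [/\ m <= kappa * eta, m <= tau0 * eta & m <= tau2].
  by rewrite /m !ge_min !lexx ?orbT.
apply/le_ereal_inf_tmp => _ [CI CIvalid <-].
apply/le_ereal_inf_tmp => _ [M Mst <-].
(* Validity under the shifted mean, read as a statement about the data
   generated with mean [M]. *)
have cov a : 0 <= a -> a <= m ->
    ((1 - alpha)%:E <=
     P [set w | ci_set CI (del11 (Xmx u M w)) (M ord0 ord0 + a)%R])%E.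
  move=> a0 am; set M' := M + a *: delta_mx ord0 ord0.
  have : ((1 - alpha)%:E <= coverage u M' CI)%E.
    apply: (le_trans CIvalid); apply: ereal_inf_lbound; exists M' => //.
    by apply: Mclass2_perturb Mst => //; rewrite ?(le_trans am).
  rewrite /coverage; congr (_ <= P _)%E.
  by apply/seteqP; split => w; rewrite /= del11_delta !mxE mulr1.
have mX := measurable_del11 u M.
have mlo := measurableT_comp (ci_lo_measurable CI) mX.
have mhi := measurableT_comp (ci_hi_measurable CI) mX.
have := expected_length_ge mlo mhi (fun w => ci_lo_le_hi CI _) _ _
  (cov m (ltW m_gt0) (lexx m)).
move=> /(_ (M ord0 ord0)); rewrite addrAC subrr add0r.
apply; first by rewrite lerDl ltW.
by have := cov 0 (lexx 0) (ltW m_gt0); rewrite addr0.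
Qed.
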